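(* Every linearly ordered $H$-closed (Hausdorff) topological semilattice is absolutely $H$-closed.
   Context: All topological spaces are assumed to be Hausdorff. A topological semigroup is a (Hausdorff) topological space with a (jointly) continuous semigroup operation. A semilattice is a semigroup whose operation is commutative and idempotent; a topological semilattice is a topological semigroup which is algebraically a semilattice. The natural order on a semilattice $E$ is: $e\leqslant f$ iff $ef=fe=e$. $E$ is linearly ordered if its natural order is linear (total). A topological semigroup $S$ is $H$-closed if $S$ is a closed subset of every (Hausdorff) topological semigroup $T$ which contains $S$ both as a subsemigroup and as a topological subspace. A topological semigroup $S$ is absolutely $H$-closed if for every continuous homomorphism $h\colon S\to T$ into a (Hausdorff) topological semigroup $T$, the image $h(S)$, with the subspace topology from $T$, is $H$-closed. *)

(* Defs.v *)
From HB Require Import structures.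
From mathcomp Require Import all_boot all_classical topology.

Set Implicit Arguments.
Unset Strict Implicit.
Unset Printing Implicit Defensive.

Local Open Scope classical_set_scope.
Local Open Scope group_scope.

HB.mixin Record isTopologicalSemigroup S & Topological S & Semigroup S := {
  topsg_hausdorff : hausdorff_space S;
  mulg_continuous : continuous (fun x : S * S => x.1 * x.2)
}.

#[short(type="topSemigroupType")]
HB.structure Definition TopologicalSemigroup :=
  {S of Topological S & Semigroup S & isTopologicalSemigroup S}.

Definition semilattice (S : semigroupType) : Prop :=
  (forall x y : S, x * y = y * x) /\ (forall x : S, x * x = x).

Definition natural_le (S : semigroupType) (e f : S) : Prop :=
  e * f = e /\ f * e = e.

Definition linearly_ordered (S : semigroupType) : Prop :=
  forall e f : S, natural_le e f \/ natural_le f e.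

Definition topological_embedding (X Y : topologicalType) (i : X -> Y) : Prop :=
  injective i /\
  forall U : set X, open U <-> exists2 V : set Y, open V & U = i @^-1` V.

(* "T contains S as a subsemigroup and as a topological subspace" is rendered,
   up to isomorphism, by an injective multiplicative map S -> T inducing the
   topology of S. *)
Definition H_closed (S : topSemigroupType) : Prop :=
  forall (T : topSemigroupType) (i : {multiplicative S -> T}),
    topological_embedding i -> closed (range i).

(* The image of a homomorphism as a topological semigroup in its own right:
   the operation is inherited from the codomain, and the topology is that of
   set_type, i.e. the subspace topology. *)
Definition hom_image (S T : topSemigroupType) (h : {multiplicative S -> T})
  : Type := set_type (range h).

Section hom_image_structure.
Variables (S T : topSemigroupType) (h : {multiplicative S -> T}).
Local Notation I := (hom_image h).

HB.instance Definition _ := Topological.copy I (set_type (range h)).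
HB.instance Definition _ := SubChoice.copy I (set_type (range h)).

Let rangeM : mulg_closed (mem (range h)).
Proof.
move=> _ _ /set_mem[x _ <-] /set_mem[y _ <-].
by apply/mem_set; exists (x * y) => //; rewrite gmulfM.
Qed.

HB.instance Definition _ :=
  SubChoice_isSubSemigroup.Build T (mem (range h)) I rangeM.

Let val_continuous : continuous (val : I -> T).
Proof. exact: (@initial_continuous _ _ (set_val : range h -> T)). Qed.

Let I_hausdorff : hausdorff_space I.
Proof.
move=> p q pq; apply: val_inj; apply: (@topsg_hausdorff T) => A B pA qB.
have [z [zA zB]] := pq _ _ (val_continuous pA) (val_continuous qB).
by exists (val z).
Qed.

Let I_mul_continuous : continuous (fun x : I * I => x.1 * x.2).
Proof.
apply: (@continuous_comp_initial I (I * I)%type T val) => -[x y].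
have -> : val \o (fun x : I * I => x.1 * x.2) =
    (fun x : T * T => x.1 * x.2) \o (fun x : I * I => (val x.1, val x.2)).
  by apply/funext => u; exact: valM.
apply: continuous_comp; last exact: mulg_continuous.
apply: cvg_pair => /=.
  by apply: cvg_comp; [exact: cvg_fst|exact: val_continuous].
by apply: cvg_comp; [exact: cvg_snd|exact: val_continuous].
Qed.

HB.instance Definition _ :=
  isTopologicalSemigroup.Build I I_hausdorff I_mul_continuous.

End hom_image_structure.

Definition absolutely_H_closed (S : topSemigroupType) : Prop :=
  forall (T : topSemigroupType) (h : {multiplicative S -> T}),
    continuous h -> H_closed (hom_image h).

(* Main.v *)
From HB Require Import structures.
From mathcomp Require Import all_boot all_classical topology.
Require Import Defs.

(** Write x <= y for x * y = x.

    The key fact is that an H-closed linearly ordered topological semilattice E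
    has no gap: if a lower set A of E is clopen, then A, when nonempty, has a
    greatest element ([H_closed_max]), and its complement, when nonempty, has a
    least element ([H_closed_min]).  Otherwise a point can be added to E between
    A and its complement, with neighbourhoods the tails of A (or the initial
    segments of the complement).  The result is a Hausdorff topological
    semilattice in which E is dense but not everything, against H-closedness
    ([gap_not_H_closed]).

    This suffices to show that every continuous homomorphism f from E to a
    Hausdorff topological semigroup has closed range ([closed_range]).  Let x be
    in the closure of f(E) but not in f(E).  For every e, the range of f is
    covered by the closed sets of the t with f(e) t = f(e) and of the t with
    f(e) t = t, so one of these equations holds for t = x, and not both since
    x <> f(e).  Hence A = {e | f(e) x = f(e)} and its complement
    {e | f(e) x = x} are closed, and A is a lower set.  Now x is in the closure
    of f(A) or in that of f(~A).  In the first case let a be the greatest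
    element of A; then f(a) t = t on f(A), hence at x, so a is not in A.  In the
    second case let b be the least element of ~A; then f(b) t = f(b) on f(~A),
    hence at x, so b is in A.  Both are absurd.

    Absolute H-closedness follows: a topological embedding of the image h(E)
    into T', composed with h, is a continuous homomorphism from E to T' with the
    same range. *)

Set Implicit Arguments.
Unset Strict Implicit.
Unset Printing Implicit Defensive.

Local Open Scope classical_set_scope.
Local Open Scope group_scope.

(** * Preliminaries *)

Section LinearSemilattice.
Variable E : topSemigroupType.
Hypotheses (slE : semilattice E) (linE : linearly_ordered E).
Implicit Types x y : E.

Lemma linear_mulg x y : x * y = x \/ x * y = y.
Proof. by case: (linE x y) => -[e f]; [left | right; rewrite slE.1]. Qed.

End LinearSemilattice.

Section Closedness.
Variable T : topSemigroupType.
Implicit Types t x : T.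

Lemma closed_eq_fun (X : topologicalType) (f g : X -> T) :
  continuous f -> continuous g -> closed [set x | f x = g x].
Proof.
move=> cf cg x clx; apply: (@topsg_hausdorff T) => A B fA gB.
have fAx : nbhs x (f @^-1` A) := cf x A fA.
have gBx : nbhs x (g @^-1` B) := cg x B gB.
have [y [/= fgy [Ay By]]] := clx _ (filterI fAx gBx).
by exists (f y); split => //; rewrite fgy.
Qed.

Lemma open_neq_fun (X : topologicalType) (f g : X -> T) :
  continuous f -> continuous g -> open [set x | f x <> g x].
Proof. by move=> cf cg; apply: closed_openC; exact: closed_eq_fun. Qed.

Lemma mulg_continuousl t : continuous (fun x => t * x).
Proof.
move=> x; apply: (@continuous2_cvg _ _ _ _ _ _ (fun=> t) id
  (fun x y : T => x * y)).
- exact: (@mulg_continuous T (t, x)).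
- exact: cvg_cst.
- exact: cvg_id.
Qed.

Lemma mulg_continuousr t : continuous (fun x => x * t).
Proof.
move=> x; apply: (@continuous2_cvg _ _ _ _ _ _ id (fun=> t)
  (fun x y : T => x * y)).
- exact: (@mulg_continuous T (x, t)).
- exact: cvg_id.
- exact: cvg_cst.
Qed.

Lemma open_not_below x : open [set y | y * x <> y].
Proof.
apply: (open_neq_fun (f := fun y => y * x)); first exact: mulg_continuousr.
by move=> y; exact: cvg_id.
Qed.

Lemma open_not_above x : open [set y | x * y <> x].
Proof.
apply: (open_neq_fun (f := fun y => x * y)); first exact: mulg_continuousl.
exact: cst_continuous.
Qed.

End Closedness.

(** * Filling a gap of a linearly ordered semilattice *)

(** A position for a new point p in a linear semilattice [E]: [gap_lower] is the
    set of the elements to lie below p, and [gap_filter] is the trace on [E] of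
    the neighbourhoods of p.  The last two conditions say that every x in [E]
    and p have neighbourhoods such that all points v of the one and q of the
    other (in [E]) are distinct and ordered as x and p are, with v on the same
    side of p as x.  One structure serves for the points approached from below
    and for those approached from above. *)
Record gap (E : topSemigroupType) := Gap {
  gap_semilattice : semilattice E;
  gap_linear : linearly_ordered E;
  gap_lower : set E;
  gap_filter : set_system E;
  gap_proper : ProperFilter gap_filter;
  gap_interior : forall Q, gap_filter Q -> gap_filter Q°;
  gap_below : forall x, gap_lower x -> exists V Q,
    [/\ nbhs x V, gap_filter Q & forall v q, V v -> Q q ->
      [/\ gap_lower v, v * q = v & v <> q]];
  gap_above : forall x, ~ gap_lower x -> exists V Q,
    [/\ nbhs x V, gap_filter Q & forall v q, V v -> Q q ->
      [/\ ~ gap_lower v, v * q = q & v <> q]]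
}.

(** The semilattice [E] with the new point, represented by [None]. *)
Definition gap_extension (E : topSemigroupType) (g : gap E) : Type := option E.

Section GapExtension.
Variables (E : topSemigroupType) (g : gap E).
Local Notation A := (gap_lower g).
Local Notation F := (gap_filter g).
Local Notation X := (gap_extension g).
Let slE := gap_semilattice g.
Let linE := gap_linear g.
#[local] Existing Instance gap_proper.

(** Elements below the gap are below those above it: compare both with an
    element close to the new point. *)
Lemma gap_lower_mul (x y : E) : A x -> ~ A y -> x * y = x.
Proof.
move=> Ax Ay.
have [V [P [Vx FP VP]]] := gap_below Ax.
have [W [Q [Wy FQ WQ]]] := gap_above Ay.
have [q [Pq Qq]] := filter_ex (filterI FP FQ).
have [_ xq _] := VP _ _ (nbhs_singleton Vx) Pq.
have [_ yq _] := WQ _ _ (nbhs_singleton Wy) Qq.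
by rewrite -xq -mulgA (slE.1 q) yq.
Qed.

HB.instance Definition _ := Choice.on X.

(** The minimum for the linear order of [E] extended to the new point. *)
Definition gap_mul (p q : X) : X :=
  match p, q with
  | Some x, Some y => Some (x * y)
  | Some x, None | None, Some x => if `[< A x >] then Some x else None
  | None, None => None
  end.

Lemma gap_mulC : commutative gap_mul.
Proof. by move=> [x|] [y|] //=; rewrite slE.1. Qed.

Lemma gap_lowerM (x y : E) :
  `[< A (x * y) >] = `[< A x >] || `[< A y >].
Proof.
have mulC := slE.1.
have [Ax|nAx] := asboolP (A x); have [Ay|nAy] := asboolP (A y);
  apply/asboolP => /=.
- by case: (linear_mulg slE linE x y) => ->.
- by rewrite gap_lower_mul.
- by rewrite mulC gap_lower_mul.
- by case: (linear_mulg slE linE x y) => ->.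
Qed.

Lemma gap_mulA : associative gap_mul.
Proof.
have mulC := slE.1.
move=> [x|] [y|] [z|] //=; rewrite ?mulgA //.
- rewrite gap_lowerM; have [Ay|nAy] := asboolP (A y) => /=.
    by rewrite orbT.
  by rewrite orbF; have [Ax|nAx] := asboolP (A x); rewrite /= ?gap_lower_mul.
- have [Ax|nAx] := asboolP (A x); have [Az|nAz] := asboolP (A z) => //=.
  + by rewrite gap_lower_mul.
  + by case: asboolP => // _; rewrite mulC gap_lower_mul.
  + by case: asboolP.
- by have [Ax|] := asboolP (A x) => //=; case: asboolP.
- rewrite gap_lowerM; have [Ay|nAy] := asboolP (A y) => //=.
  by have [Az|nAz] := asboolP (A z); rewrite //= mulC gap_lower_mul.
- by have [Az|] := asboolP (A z) => //=; case: asboolP.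
Qed.

(** The points of [E] keep their neighbourhoods, so that [E] is open. *)
Definition gap_nbhs (p : X) : set_system X :=
  match p with
  | Some x => [set W | nbhs x (Some @^-1` W)]
  | None => [set W | W None /\ F (Some @^-1` W)]
  end.

HB.instance Definition _ := hasNbhs.Build X gap_nbhs.

Lemma gap_nbhs_filter (p : X) : ProperFilter (nbhs p).
Proof.
case: p => [x|]; split.
- exact: (@filter_not_empty _ (nbhs x)).
- by split; [exact: filterT | move=> ? ?; exact: filterI |
             move=> ? ? s; apply: filterS => y; exact: s].
- by case.
- split; first by split => //; exact: filterT.
    by move=> ? ? [? ?] [? ?]; split => //; exact: filterI.
  move=> P Q s [? FP]; split; first exact: s.
  by apply: filterS FP => y; exact: s.
Qed.

Lemma gap_nbhs_singleton (p : X) (W : set X) : nbhs p W -> W p.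
Proof. by case: p => [x /nbhs_singleton|[]]. Qed.

Lemma gap_nbhs_nbhs (p : X) (W : set X) : nbhs p W -> nbhs p (nbhs^~ W).
Proof.
case: p => [x|]; first exact: nbhs_interior.
by move=> [W0 FW]; split => //; exact: (gap_interior FW).
Qed.

HB.instance Definition _ := Nbhs_isNbhsTopological.Build X
  gap_nbhs_filter gap_nbhs_singleton gap_nbhs_nbhs.

HB.instance Definition _ := isSemigroup.Build X gap_mulA.

Lemma gap_separated (x : E) : exists V Q,
  [/\ nbhs x V, F Q & forall v q, V v -> Q q -> v <> q].
Proof.
have [/gap_below|/gap_above] := pselect (A x) => -[V [Q [Vx FQ H]]];
  by exists V, Q; split => // v q Vv Qq; case: (H v q Vv Qq).
Qed.

Lemma gap_hausdorff : hausdorff_space X.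
Proof.
have sep (x : E) : ~ cluster (nbhs (Some x : X)) None.
  have [V [Q [Vx FQ VQ]]] := gap_separated x.
  move=> /(_ (Some @` V) [set p | if p is Some q then Q q else True]).
  case=> //.
    by apply: filterS Vx => v Vv; exists v.
  by move=> _ [[v Vv <-] Qv]; exact: (VQ v v).
move=> [x|] [y|] //.
- move=> xy; congr Some; apply: (@topsg_hausdorff E) => P Q xP yQ.
  have [||_ [[u Pu <-] [v Qv [vu]]]] := xy (Some @` P) (Some @` Q).
  + by apply: filterS xP => u; exists u.
  + by apply: filterS yQ => u; exists u.
  by exists u; split => //; rewrite -vu.
- by move=> /sep.
- by move=> xy; case: (sep y) => P Q yP Q0; rewrite setIC; exact: xy.
Qed.

(** Joint continuity of the product.  Near a pair of a point x of [E] and the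
    new point, the product is one of the two projections, because of
    [gap_below] or [gap_above]. *)
Lemma gap_mul_nbhs (p q : X) (W : set X) : nbhs (p * q) W ->
  exists U V, [/\ nbhs p U, nbhs q V & forall u v, U u -> V v -> W (u * v)].
Proof.
have sN (x : E) (V : set E) : nbhs x V -> nbhs (Some x : X) (Some @` V).
  by apply: filterS => v; exists v.
have mixed (x : E) : nbhs ((Some x : X) * (None : X)) W ->
  exists U V, [/\ nbhs (Some x : X) U, nbhs (None : X) V &
               forall u v, U u -> V v -> W (u * v)].
  rewrite {1}/mul /=; case: asboolP => Ax.
    move=> xW; have [V [Q [Vx FQ VQ]]] := gap_below Ax.
    exists (Some @` (V `&` Some @^-1` W)), (None |` Some @` Q); split.
    - by apply: sN; exact: filterI.
    - by split; [left | apply: filterS FQ => v; right; exists v].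
    - move=> _ _ [v [Vv Wv] <-] [->|[w Qw <-]]; rewrite /mul /=.
        have [r Qr] := filter_ex FQ.
        by have [/asboolP -> _ _] := VQ _ _ Vv Qr.
      by have [_ -> _] := VQ _ _ Vv Qw.
  move=> [W0 FW]; have [V [Q [Vx FQ VQ]]] := gap_above Ax.
  exists (Some @` V), (None |` Some @` (Q `&` Some @^-1` W)); split.
  - exact: sN.
  - split; first by left.
    by apply: filterS (filterI FQ FW) => v; right; exists v.
  - move=> _ _ [v Vv <-] [->|[w [Qw Ww] <-]]; rewrite /mul /=.
      have [r Qr] := filter_ex FQ.
      by have [/asboolPn/negbTE -> _ _] := VQ _ _ Vv Qr.
    by have [_ -> _] := VQ _ _ Vv Qw.
case: p q => [x|] [y|].
- move=> xyW; have [[U V] /= [xU yV] UV] := @mulg_continuous E (x, y) _ xyW.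
  exists (Some @` U), (Some @` V); split; [exact: sN | exact: sN |].
  by move=> _ _ [u Uu <-] [v Vv <-]; exact: (UV (u, v)).
- exact: mixed.
- rewrite [_ * _]gap_mulC => /mixed[U [V [yU V0 UV]]]; exists V, U; split => //.
  by move=> v u Vv Uu; rewrite [_ * _]gap_mulC; exact: UV.
- move=> [W0 FW]; exists (None |` Some @` (Some @^-1` W)).
  exists (None |` Some @` (Some @^-1` W)).
  have N0 : nbhs (None : X) (None |` Some @` (Some @^-1` W)).
    by split; [left | apply: filterS FW => v; right; exists v].
  have WN : (None |` Some @` (Some @^-1` W)) `<=` W by move=> _ [->|[v Wv <-]].
  split => // -[u|] [v|] /WN Wu /WN Wv //; rewrite /mul /=.
  + by case: (linear_mulg slE linE u v) => ->.
  + by case: ifP.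
  + by case: ifP.
Qed.

Lemma gap_mul_continuous : continuous (fun p : X * X => p.1 * p.2).
Proof.
move=> [p q] W /gap_mul_nbhs[U [V [pU qV UV]]].
by exists (U, V) => // -[u v] [/= Uu Vv]; exact: UV.
Qed.

HB.instance Definition _ :=
  isTopologicalSemigroup.Build X gap_hausdorff gap_mul_continuous.

(** The embedding of [E], as a map into the extension. *)
Definition gap_inj (x : E) : X := Some x.

Lemma gap_injM : {morph gap_inj : x y / x * y >-> x * y}.
Proof. by []. Qed.

HB.instance Definition _ := isMultiplicative.Build E X gap_inj gap_injM.

Lemma gap_inj_embedding : topological_embedding gap_inj.
Proof.
split=> [x y [] //|U]; split.
  move=> oU; exists (Some @` U).
    rewrite openE => _ [x Ux <-].
    by apply: filterS (open_nbhs_nbhs (conj oU Ux)) => y Uy; exists y.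
  by rewrite predeqE => x; split=> [Ux|[y Uy [<-]]//]; exists x.
by move=> [V oV ->]; rewrite openE => x Vx; move: (open_nbhs_nbhs (conj oV Vx)).
Qed.

Lemma gap_not_H_closed : ~ H_closed E.
Proof.
move=> /(_ X gap_inj gap_inj_embedding) cl.
have [x _ //] : range gap_inj None.
apply: cl => W [W0 FW]; have [x Wx] := filter_ex FW.
by exists (Some x); split => //; exists x.
Qed.

End GapExtension.

(** * Clopen cuts of H-closed semilattices *)

Section HClosedCuts.
Variable E : topSemigroupType.
Hypotheses (slE : semilattice E) (linE : linearly_ordered E).
Hypothesis hE : H_closed E.
Variable A : set E.
Hypotheses (clA : closed A) (opA : open A).
Hypothesis lowA : forall x y, A x -> ~ A y -> x * y = x.

Let openA' : open (~` A). Proof. by rewrite openC. Qed.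

Lemma H_closed_max : A !=set0 -> exists2 a, A a & forall x, A x -> x * a = x.
Proof.
move=> [a0 Aa0]; apply: contrapT => nomax.
have mulC := slE.1.
have up x : A x -> exists2 e, A e & e * x <> e.
  move=> Ax; apply: contrapT => nex; apply: nomax; exists x => // y Ay.
  by apply: contrapT => yx; apply: nex; exists y.
(* The new point is the limit of the tails of A. *)
pose tail e := A `&` [set y | y * e <> y].
have tail_open e : open (tail e) by apply: openI => //; exact: open_not_below.
have PF : ProperFilter (filter_from A tail).
  apply: filter_from_proper; last first.
    by move=> e /up[y Ay ye]; exists y.
  apply: filter_from_filter; first by exists a0.
  move=> i j Ai Aj; case: (linear_mulg slE linE i j) => ij.
    exists j => // y [Ay yj]; split; split => // yi; apply: yj.
    by rewrite -yi -mulgA ij.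
  exists i => // y [Ay yi]; split; split => // yj; apply: yi.
  by rewrite -yj -mulgA (mulC j) ij.
have Fint Q : filter_from A tail Q -> filter_from A tail Q°.
  by move=> [e Ae eQ]; exists e => //; rewrite -open_subsetE.
have below x : A x -> exists V Q, [/\ nbhs x V, filter_from A tail Q &
    forall v q, V v -> Q q -> [/\ A v, v * q = v & v <> q]].
  move=> Ax.
  (* An element e of A above x separates x from the tail above e. *)
  have [e Ae ex] := up _ Ax.
  exists (A `&` [set v | e * v <> e]), (tail e); split; last 1 first.
  - move=> v q [Av ev] [Aq qe].
    have {}ev : v * e = v by rewrite mulC; case: (linear_mulg slE linE e v).
    have eq_ : e * q = e by rewrite mulC; case: (linear_mulg slE linE q e).
    split => //; first by rewrite -ev -mulgA eq_.
    by move=> vq; apply: qe; rewrite -vq.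
  - apply: open_nbhs_nbhs; split => //.
    by apply: openI => //; exact: open_not_above.
  - by exists e.
have above x : ~ A x -> exists V Q, [/\ nbhs x V, filter_from A tail Q &
    forall v q, V v -> Q q -> [/\ ~ A v, v * q = q & v <> q]].
  move=> nAx; exists (~` A), (tail a0); split.
  - exact: open_nbhs_nbhs.
  - by exists a0.
  - move=> v q nAv [Aq _]; split; [exact: nAv | by rewrite mulC lowA |].
    by move=> vq; apply: nAv; rewrite vq.
exact: (gap_not_H_closed (Gap slE linE PF Fint below above)).
Qed.

Lemma H_closed_min : (~` A) !=set0 ->
  exists2 b, ~ A b & forall x, ~ A x -> b * x = b.
Proof.
move=> [b0 Ab0]; apply: contrapT => nomin.
have mulC := slE.1.
have down x : ~ A x -> exists2 e, ~ A e & x * e <> x.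
  move=> Ax; apply: contrapT => nex; apply: nomin; exists x => // y Ay.
  by apply: contrapT => xy; apply: nex; exists y.
(* The new point is the limit of the initial segments of the complement. *)
pose tail e := ~` A `&` [set y | e * y <> e].
have tail_open e : open (tail e) by apply: openI => //; exact: open_not_above.
have PF : ProperFilter (filter_from (~` A) tail).
  apply: filter_from_proper; last first.
    by move=> e /down[y Ay ye]; exists y.
  apply: filter_from_filter; first by exists b0.
  move=> i j Ai Aj; case: (linear_mulg slE linE i j) => ij.
    exists i => // y [Ay iy]; split; split => // jy; apply: iy.
    by rewrite -ij -mulgA jy.
  exists j => // y [Ay jy]; split; split => // iy; apply: jy.
  by rewrite -ij mulC mulgA (mulC y) iy.
have Fint Q : filter_from (~` A) tail Q -> filter_from (~` A) tail Q°.
  by move=> [e Ae eQ]; exists e => //; rewrite -open_subsetE.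
have below x : A x -> exists V Q, [/\ nbhs x V, filter_from (~` A) tail Q &
    forall v q, V v -> Q q -> [/\ A v, v * q = v & v <> q]].
  move=> Ax; exists A, (tail b0); split.
  - exact: open_nbhs_nbhs.
  - by exists b0.
  - move=> v q Av [Aq _]; split; [by [] | exact: lowA |].
    by move=> vq; apply: Aq; rewrite -vq.
have above x : ~ A x -> exists V Q, [/\ nbhs x V, filter_from (~` A) tail Q &
    forall v q, V v -> Q q -> [/\ ~ A v, v * q = q & v <> q]].
  move=> nAx.
  (* An element e below x, outside A, separates x from the initial segment
     below e. *)
  have [e nAe xe] := down _ nAx.
  exists (~` A `&` [set v | v * e <> v]), (tail e); split; last 1 first.
  - move=> v q [nAv ve] [nAq eq].
    have {}ve : v * e = e by case: (linear_mulg slE linE v e).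
    have eq' : e * q = q by case: (linear_mulg slE linE e q).
    split => //; first by rewrite -eq' mulgA ve.
    by move=> vq; apply: eq; rewrite -vq mulC.
  - apply: open_nbhs_nbhs; split => //.
    by apply: openI => //; exact: open_not_below.
  - by exists e.
exact: (gap_not_H_closed (Gap slE linE PF Fint below above)).
Qed.

End HClosedCuts.

(** * Images of H-closed semilattices *)

Lemma closed_range (E : topSemigroupType) (slE : semilattice E)
  (linE : linearly_ordered E) (hE : H_closed E) (T : topSemigroupType)
  (f : E -> T) : continuous f -> {morph f : x y / x * y >-> x * y} ->
  closed (range f).
Proof.
move=> cf fM x clx; apply: contrapT => xf.
have mulC := slE.1.
have fix_closed e : closed [set t | f e * t = t].
  apply: (closed_eq_fun (f := fun t => f e * t)); first exact: mulg_continuousl.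
  by move=> ?; exact: cvg_id.
have abs_closed e : closed [set t | f e * t = f e].
  apply: (closed_eq_fun (f := fun t => f e * t)); first exact: mulg_continuousl.
  exact: cst_continuous.
have mulx e : f e * x = f e \/ f e * x = x.
  have := closedU (abs_closed e) (fix_closed e); apply.
  apply: closure_subset clx => _ [y _ <-].
  by case: (linear_mulg slE linE e y) => ey; [left|right]; rewrite /= -fM ey.
have fMx_continuous : continuous (fun e => f e * x).
  move=> e; apply: (@continuous_comp _ _ _ f (fun t => t * x)); first exact: cf.
  exact: mulg_continuousr.
pose A := [set e | f e * x = f e].
have nAE : ~` A = [set e | f e * x = x].
  apply/seteqP; split => e /=; first by case: (mulx e).
  by move=> fx Ae; apply: xf; exists e => //; rewrite -fx Ae.
have clA : closed A by exact: closed_eq_fun.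
have opA : open A.
  rewrite -[A]setCK openC nAE; apply: closed_eq_fun => //.
  exact: cst_continuous.
have lowA e y : A e -> ~ A y -> e * y = e.
  move=> Ae nAy; case: (linear_mulg slE linE e y) => // ey.
  (* If y <= e then f e * x = f e * f y * x = f y * x = x, so e is not in A. *)
  have yx : f y * x = x by have : (~` A) y by []; rewrite nAE.
  have : (~` A) e by rewrite nAE /= -{1}yx mulgA -fM ey.
  by [].
have : closure (f @` A `|` f @` (~` A)) x by rewrite -image_setU setUv.
rewrite closureU => -[clAx|clBx].
- have [_ [[a0 Aa0 _] _]] := clAx _ filterT.
  have [|a Aa maxa] := H_closed_max slE linE hE clA opA lowA.
    by exists a0.
  suff : (~` A) a by [].
  rewrite nAE; apply: (fix_closed a).
  by apply: closure_subset clAx => _ [e Ae <-]; rewrite /= -fM mulC maxa.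
- have [_ [[b0 nAb0 _] _]] := clBx _ filterT.
  have [|b nAb minb] := H_closed_min slE linE hE clA opA lowA.
    by exists b0.
  apply: nAb; apply: (abs_closed b).
  by apply: closure_subset clBx => _ [e Ae <-]; rewrite /= -fM minb.
Qed.

Theorem theorem3 (E : topSemigroupType) (slE : semilattice E)
  (linE : linearly_ordered E) (hE : H_closed E) : absolutely_H_closed E.
Proof.
move=> T h ch T' i [injI topI].
pose r (e : E) : hom_image h := exist _ (h e) (mem_set (imageP h (I : setT e))).
have rM : {morph r : x y / x * y >-> x * y}.
  by move=> x y; apply: val_inj; rewrite valM /= gmulfM.
have rC : continuous r.
  exact: (@continuous_comp_initial (set_type (range h)) E T val r).
have iC : continuous i by apply/continuousP => V oV; apply/topI; exists V.
have -> : range i = range (i \o r).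
  apply/seteqP; split => [_ [u _ <-]|_ [e _ <-]]; last by exists (r e).
  have [e _ he] := set_mem (valP u).
  by exists e => //=; congr (i _); exact: val_inj.
apply: closed_range => // [e|x y /=]; last by rewrite rM gmulfM.
by apply: continuous_comp; [exact: rC | exact: iC].
Qed.
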